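(* Let $X=(\mathbb{C}^n,\|\cdot\|)$ be a complex normed space with an adjoint complex polytope norm. Let $Y\subseteq X$ be a $1$-dimensional linear subspace and let $x\in X\setminus Y$ be a vector for which $y_0\in Y$ is a unique best approximation in $Y$. Then $y_0$ is a $2$-strongly unique best approximation for $x$ in $Y$.
   Context: A norm on $\mathbb{C}^n$ is an adjoint complex polytope norm if there are finitely many linear functionals $f_1,\dots,f_N:\mathbb{C}^n\to\mathbb{C}$ such that $\|x\|=\max_{1\le j\le N}|f_j(x)|$ for every $x\in\mathbb{C}^n$. Throughout, $n\ge 2$. For a linear subspace $Y$ of a normed space $X$ and $x\in X$, a vector $y_0\in Y$ is a best approximation for $x$ in $Y$ if $\|x-y\|\ge\|x-y_0\|$ for all $y\in Y$; it is unique if no other element of $Y$ has this property. For a real $\alpha\ge1$, $y_0\in Y$ is an $\alpha$-strongly unique best approximation for $x$ in $Y$ if there is $r>0$ with $\|x-y\|^\alpha\ge\|x-y_0\|^\alpha+r\|y-y_0\|^\alpha$ for all $y\in Y$. *)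

(* Defs.v *)
From HB Require Import structures.
From mathcomp Require Import all_boot all_order all_algebra.
From mathcomp Require Import complex.
From mathcomp Require Import reals exp.

Set Implicit Arguments.
Unset Strict Implicit.
Unset Printing Implicit Defensive.

Import Order.TTheory GRing.Theory Num.Theory.
Local Open Scope ring_scope.

(* The complex numbers are R[i] for R : realType; `|z| is then valued in R[i],
   so norms and moduli are taken in R, with ComplexField.Normc.normc z the real
   modulus of z. *)
Notation cmod := ComplexField.Normc.normc.

Definition is_norm (R : realType) (V : lmodType R[i]) (nrm : V -> R) : Prop :=
  [/\ forall x, 0 <= nrm x,
      forall x, nrm x = 0 -> x = 0,
      forall (c : R[i]) x, nrm (c *: x) = cmod c * nrm x
    & forall x y, nrm (x + y) <= nrm x + nrm y].

(* The moduli are nonnegative, so 0 as a default value for the maximum matters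
   only for an empty family. An empty family would give nrm = 0, which is not
   a norm when n > 0. *)
Definition adjoint_polytope_norm (R : realType) (n : nat)
    (nrm : 'cV[R[i]]_n -> R) : Prop :=
  is_norm nrm /\
  exists (N : nat) (f : 'I_N -> {linear 'cV[R[i]]_n -> R[i]^o}),
    forall x, nrm x = \big[Num.max/0]_(j < N) cmod (f j x).

Section BestApproximation.
Variables (R : realType) (V : vectType R[i]) (nrm : V -> R).

Definition best_approx (Y : {vspace V}) (x y0 : V) : Prop :=
  y0 \in Y /\ forall y, y \in Y -> nrm (x - y0) <= nrm (x - y).

Definition unique_best_approx (Y : {vspace V}) (x y0 : V) : Prop :=
  best_approx Y x y0 /\ forall y, best_approx Y x y -> y = y0.

(* Meant for alpha >= 1. *)
Definition strongly_unique_best_approx (alpha : R) (Y : {vspace V})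
    (x y0 : V) : Prop :=
  y0 \in Y /\
  exists2 r : R, 0 < r &
    forall y, y \in Y ->
      powR (nrm (x - y0)) alpha + r * powR (nrm (y - y0)) alpha
        <= powR (nrm (x - y)) alpha.

End BestApproximation.

(* Main.v *)
(** Put [z = x - y0]. If some [w] in [Y] had [Re (conj (f_j z) * f_j w) > 0]
    for every [j] with [|f_j z| = nrm z] and [f_j w <> 0], then [t w] with
    [t > 0] small would give another best approximation [y0 + t w]. Hence each
    nonzero [w] in [Y] admits a [j] with [|f_j z| = nrm z], [f_j w <> 0] and
    [Re (conj (f_j z) * f_j w) <= 0], so that
    [nrm (z - w) ^ 2 >= |f_j (z - w)| ^ 2 >= nrm z ^ 2 + |f_j w| ^ 2].
    As [Y] is a line, [|f_j w| / nrm w] takes only finitely many values. *)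
Require Import Defs.
From HB Require Import structures.
From mathcomp Require Import all_boot all_order all_algebra.
From mathcomp Require Import complex.
From mathcomp Require Import reals exp.
From mathcomp Require Import ring lra.

Set Implicit Arguments.
Unset Strict Implicit.
Unset Printing Implicit Defensive.

Local Open Scope ring_scope.
Import Order.TTheory GRing.Theory Num.Theory.

(** The least of finitely many positive thresholds is positive. This supplies both a step length
    that suits all functionals and the constant [r] of strong uniqueness. *)
Lemma fin_eventually_small (R : realType) (I : finType) (P : I -> R -> Prop) :
  (forall i, exists2 e, 0 < e & forall t, 0 < t <= e -> P i t) ->
  exists2 e, 0 < e & forall i t, 0 < t <= e -> P i t.
Proof.
move=> H.
suff [e e0 He] : exists2 e, 0 < e &
    forall i t, i \in enum I -> 0 < t <= e -> P i t.
  by exists e => // i t; apply: He; rewrite mem_enum.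
elim: (enum I) => [|i s [e e0 He]]; first by exists 1.
have [d d0 Hd] := H i; exists (Num.min d e); first by rewrite lt_min d0 e0.
move=> k t; rewrite inE le_min => /orP[/eqP->|ks] /and3P[t0 td te].
  by apply: Hd; rewrite t0.
by apply: He; rewrite // t0.
Qed.

Lemma sqr_cmod (R : rcfType) (z : R[i]) :
  cmod z ^+ 2 = complex.Re z ^+ 2 + complex.Im z ^+ 2.
Proof. by case: z => a b; rewrite /= sqr_sqrtr // addr_ge0 ?sqr_ge0. Qed.

Lemma cmod_ge0 (R : rcfType) (z : R[i]) : 0 <= cmod z.
Proof. by case: z => a b; exact: sqrtr_ge0. Qed.

(** The real part of [conj a * b], that is, the inner product of the real plane. *)
Definition Redot (R : rcfType) (a b : R[i]) : R :=
  complex.Re a * complex.Re b + complex.Im a * complex.Im b.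

Lemma sqr_cmodB (R : rcfType) (a b : R[i]) :
  cmod (a - b) ^+ 2 = cmod a ^+ 2 - 2 * Redot a b + cmod b ^+ 2.
Proof. by rewrite !sqr_cmod /Redot; case: a b => [a1 a2] [b1 b2] /=; ring. Qed.

Lemma RedotZr (R : rcfType) (t : R) (a b : R[i]) :
  Redot a (t%:C%C * b) = t * Redot a b.
Proof. by rewrite /Redot; case: a b => [a1 a2] [b1 b2] /=; ring. Qed.

Lemma sqr_cmodZ (R : rcfType) (t : R) (b : R[i]) :
  cmod (t%:C%C * b) ^+ 2 = t ^+ 2 * cmod b ^+ 2.
Proof. by rewrite !sqr_cmod; case: b => [b1 b2] /=; ring. Qed.

(** If [cmod a < M], there is slack for a small move. If [cmod a = M], the linear term
    [- 2 * t * Redot a b] of the squared modulus beats the quadratic one for small [t]. *)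
Lemma cmodB_small_le (R : realType) (M : R) (a b : R[i]) :
  cmod a <= M -> (cmod a = M -> b != 0 -> 0 < Redot a b) ->
  exists2 e, 0 < e & forall t, 0 < t <= e -> cmod (a - t%:C%C * b) <= M.
Proof.
move=> aM hab; have a0 := cmod_ge0 a; have M0 := le_trans a0 aM.
have [->|bN0] := eqVneq b 0.
  by exists 1 => // t _; rewrite mulr0 subr0.
have B0 : 0 <= cmod b ^+ 2 by exact: sqr_ge0.
suff [e e0 He] : exists2 e, 0 < e & forall t, 0 < t <= e ->
    t * (t * cmod b ^+ 2 - 2 * Redot a b) <= M ^+ 2 - cmod a ^+ 2.
  exists e => // t /He Ht.
  rewrite -(@ler_pXn2r _ 2) ?nnegrE ?cmod_ge0 //.
  by rewrite sqr_cmodB RedotZr sqr_cmodZ; lra.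
move: aM; rewrite le_eqVlt => /orP[/eqP aM|aM].
  (* For such [t], [t * cmod b ^+ 2 <= Redot a b], so the second factor is negative. The [+ 1] keeps
     the denominator positive. *)
  have p0 := hab aM bN0; exists (Redot a b / (cmod b ^+ 2 + 1)).
    by rewrite divr_gt0 // ltr_wpDl.
  move=> t /andP[t0]; rewrite ler_pdivlMr ?ltr_wpDl // => tp.
  rewrite aM subrr; nra.
have D0 : 0 < M ^+ 2 - cmod a ^+ 2.
  by rewrite subr_gt0 ltr_pXn2r ?nnegrE.
have K0 : 0 < cmod b ^+ 2 + 2 * `|Redot a b| + 1.
  by have := normr_ge0 (Redot a b); lra.
(* The bound [t <= 1] puts the second factor below the denominator used here. *)
exists (Num.min 1 ((M ^+ 2 - cmod a ^+ 2) /
   (cmod b ^+ 2 + 2 * `|Redot a b| + 1))).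
  by rewrite lt_min ltr01 divr_gt0.
move=> t; rewrite le_min ler_pdivlMr // => /and3P[t0 t1 tD].
apply: le_trans tD; rewrite ler_pM2l //.
have := ler_norm (- Redot a b); rewrite normrN.
nra.
Qed.

Section PolytopeNorm.
Variables (R : realType) (V : vectType R[i]) (nrm : V -> R).
Variables (N : nat) (f : 'I_N -> {linear V -> R[i]^o}).
Hypothesis nrm_ge0 : forall x, 0 <= nrm x.
Hypothesis nrmE : forall x, nrm x = \big[Num.max/0]_(j < N) cmod (f j x).

Lemma cmod_le_nrm j x : cmod (f j x) <= nrm x.
Proof. by rewrite nrmE; apply: (le_bigmax _ (fun j => cmod (f j x))). Qed.

Lemma unique_best_approx_active (Y : {vspace V}) (x y0 w : V) :
  unique_best_approx nrm Y x y0 -> w \in Y -> w != 0 ->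
  exists j, [/\ cmod (f j (x - y0)) = nrm (x - y0), f j w != 0
              & Redot (f j (x - y0)) (f j w) <= 0].
Proof.
move=> [[y0Y y0best] y0uniq] wY wN0; set z := x - y0.
have [/existsP[j /and3P[/eqP ? ? ?]]|/existsPn none] := boolP [exists j,
  [&& cmod (f j z) == nrm z, f j w != 0 & Redot (f j z) (f j w) <= 0]].
  by exists j.
have [|e e0 He] := @fin_eventually_small R 'I_N
  (fun j t => cmod (f j z - t%:C%C * f j w) <= nrm z).
  move=> j; apply: cmodB_small_le; first exact: cmod_le_nrm.
  move=> jE jw; have := none j; rewrite jE eqxx jw /=.
  by rewrite -ltNge.
have ewY : e%:C%C *: w \in Y by rewrite memvZ.
have eN0 : e%:C%C != 0 :> R[i] by rewrite eq_complex /= negb_and gt_eqF.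
(* The moved point is again a best approximation, so uniqueness forces [e%:C%C *: w = 0], which is
   absurd. *)
have /eqP : y0 + e%:C%C *: w = y0.
  apply: y0uniq; split; first by rewrite memvD.
  move=> y yY; apply: le_trans (y0best y yY).
  rewrite opprD addrA -/z nrmE; apply: bigmax_le => // j _.
  by rewrite linearB linearZ; apply: He; rewrite e0 lexx.
by rewrite -subr_eq0 addrAC subrr add0r scaler_eq0 (negPf eN0) (negPf wN0).
Qed.

(** For the active [j], the cross term in the expansion of [cmod (f j (x - y0) - f j w) ^+ 2] is
    nonnegative. *)
Lemma unique_best_approx_sqr_ge (Y : {vspace V}) (x y0 w : V) :
  unique_best_approx nrm Y x y0 -> w \in Y -> w != 0 ->
  exists2 j, f j w != 0 &
    nrm (x - y0) ^+ 2 + cmod (f j w) ^+ 2 <= nrm (x - y0 - w) ^+ 2.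
Proof.
move=> uba wY wN0.
have [j [jE jw jp]] := unique_best_approx_active uba wY wN0.
exists j => //; apply: (@le_trans _ _ (cmod (f j (x - y0 - w)) ^+ 2)).
  by rewrite linearB sqr_cmodB jE; lra.
by rewrite ler_pXn2r ?nnegrE ?cmod_ge0 // cmod_le_nrm.
Qed.

End PolytopeNorm.

Theorem mainTheorem2 (R : realType) (n : nat) (hn : (2 <= n)%N)
    (nrm : 'cV[R[i]]_n -> R) (hnrm : adjoint_polytope_norm nrm)
    (Y : {vspace 'cV[R[i]]_n}) (hY : \dim Y = 1%N)
    (x y0 : 'cV[R[i]]_n) (hx : x \notin Y)
    (hy0 : unique_best_approx nrm Y x y0) :
  strongly_unique_best_approx nrm 2 Y x y0.
Proof.
have [[nrm0 nrm_eq0 nrmZ nrmD] [N [f nrmE]]] := hnrm.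
have y0Y := hy0.1.1.
have [v YE] : exists v, Y = <[v]>%VS.
  case: (vbasis Y) (vbasisP Y); rewrite hY => -[|v []] //= sz.
  by move/andP => [/eqP <- _]; exists v; rewrite span_seq1.
split=> //.
(* The index [j] found below varies with [y], so [r] must serve every [j] with [f j v != 0]. *)
have [r r0 Hr] : exists2 r, 0 < r & forall j t, 0 < t <= r ->
    f j v != 0 -> t * nrm v ^+ 2 <= cmod (f j v) ^+ 2.
  apply: (@fin_eventually_small R 'I_N (fun j t =>
    f j v != 0 -> t * nrm v ^+ 2 <= cmod (f j v) ^+ 2)) => j.
  have [->|fN0] := eqVneq (f j v) 0; first by exists 1.
  have c0 : 0 < cmod (f j v) ^+ 2.
    rewrite exprn_gt0 // lt_neqAle cmod_ge0 andbT eq_sym.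
    by apply: contra fN0 => /eqP/ComplexField.Normc.eq0_normc->.
  have K0 : 0 < nrm v ^+ 2 + 1 by rewrite ltr_wpDl ?sqr_ge0.
  exists (cmod (f j v) ^+ 2 / (nrm v ^+ 2 + 1)); first by rewrite divr_gt0.
  by move=> t /andP[t0]; rewrite ler_pdivlMr // => tc _; nra.
exists r => // y yY; rewrite !powR_mulrn //.
have [->|yN] := eqVneq y y0.
  have -> : nrm (y0 - y0) = 0.
    by rewrite subrr -(scale0r (0 : 'cV_n)) nrmZ /= expr0n /= addr0 sqrtr0 mul0r.
  by rewrite expr0n /= mulr0 addr0.
have wY : y - y0 \in Y by rewrite memvB.
have wN0 : y - y0 != 0 by rewrite subr_eq0.
have [j jw] := unique_best_approx_sqr_ge nrm0 nrmE hy0 wY wN0.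
rewrite opprB addrA addrNK; apply: le_trans; rewrite lerD2l.
(* With [y - y0 = k *: v], both sides carry the factor [cmod k ^+ 2], which reduces the claim to the
   choice of [r] at [v]. *)
move: wY jw; rewrite YE => /vlineP[k ->].
rewrite linearZ nrmZ => kv.
rewrite ComplexField.Normc.normcM !exprMn mulrCA ler_wpM2l ?sqr_ge0 //.
apply: Hr; first by rewrite r0 lexx.
by apply: contraNneq kv => ->; rewrite /= scaler0.
Qed.
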